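(* Let $\pi$ be a set of primes, and let $G$ be a finite $\pi$-separable group. Suppose $\chi \in \mathrm{Irr}(G)$ satisfies $\chi^\pi = \phi \in \mathrm{I}_\pi(G)$. If $\chi$ is monomial, then $\phi$ is monomial.
   Context: All groups are finite and characters are complex; $\mathrm{Irr}(G)$ is the set of irreducible complex characters of $G$. A character of $G$ is monomial if it is induced from a linear character of some subgroup (possibly $G$ itself). Let $G$ be $\pi$-separable. Let $G^\pi$ be the set of elements of $G$ whose order is a $\pi$-number. For a character $\chi$ of $G$, $\chi^\pi$ denotes the restriction of $\chi$ to $G^\pi$; the functions $\chi^\pi$ are called the $\pi$-partial characters of $G$. $\mathrm{I}_\pi(G)$ is the set of irreducible $\pi$-partial characters, i.e. those that cannot be written as a sum of two $\pi$-partial characters. If $H \le G$ and $\nu$ is a $\pi$-partial character of $H$, the induced $\pi$-partial character is $\nu^G(g) = \frac{1}{|H|}\sum_{x \in G,\ xgx^{-1}\in H}\nu(xgx^{-1})$ for $g \in G^\pi$. A $\pi$-partial character $\phi$ is linear if $\phi(1)=1$, and monomial if it is induced from a linear $\pi$-partial character of some subgroup (possibly $G$). *)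

(* Defs.v *)
From HB Require Import structures.
From mathcomp Require Import all_boot all_order all_fingroup all_algebra.
From mathcomp Require Import all_solvable all_field all_character.
Set Implicit Arguments.
Unset Strict Implicit.
Unset Printing Implicit Defensive.
Import GroupScope GRing.Theory.
Local Open Scope ring_scope.

(* Sets of primes are represented by [nat_pred]: the notions [pi.-nat],        *)
(* [pi.-elt] and [pi.-group] only ever test [pi] on primes.                    *)

(* There is a series 1 = N_0 <= N_1 <= ... <= N_r = G of normal subgroups of G *)
(* each of whose factors is a pi-group or a pi'-group.                         *)
Definition pi_separable (gT : finGroupType) (pi : nat_pred)
    (G : {group gT}) : Prop :=
  exists2 s : seq {group gT},
    path (fun K H : {group gT} =>
            [&& K \subset H, H <| G & pi.-group (H / K)%g || pi^'.-group (H / K)%g])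
         1%G s
    & last 1%G s = G.

Definition pi_elements (gT : finGroupType) (pi : nat_pred)
    (G : {group gT}) : {set gT} :=
  [set x in G | pi.-elt x].

Fact cf_pi_subproof (gT : finGroupType) (pi : nat_pred) (G : {group gT})
    (chi : 'CF(G)) :
  is_class_fun <<G>>
    [ffun x => if x \in pi_elements pi G then chi x else 0].
Proof.
rewrite genGid; apply: intro_class_fun => [x y Gx Gy | x notGx].
  by rewrite !inE groupJ // Gx p_eltJ cfunJ.
by rewrite inE (negPf notGx).
Qed.

(* chi^pi, the restriction of chi to the set G^pi of pi-elements of G.  A      *)
(* class function on G^pi is represented by its extension by zero, that is, by *)
(* an element of 'CF(G, pi_elements pi G).                                     *)
Definition cf_pi (gT : finGroupType) (pi : nat_pred) (G : {group gT})
    (chi : 'CF(G)) : 'CF(G) :=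
  Cfun 1 (cf_pi_subproof pi chi).

Lemma cf_piE (gT : finGroupType) (pi : nat_pred) (G : {group gT})
    (chi : 'CF(G)) x :
  cf_pi pi chi x = if x \in pi_elements pi G then chi x else 0.
Proof. exact: cfunElock. Qed.

Lemma cf_pi_on (gT : finGroupType) (pi : nat_pred) (G : {group gT})
    (chi : 'CF(G)) : cf_pi pi chi \in 'CF(G, pi_elements pi G).
Proof. by apply/cfun_onP=> x /negPf notAx; rewrite cf_piE notAx. Qed.

(* MathComp's [character] contains 0, which is not a character here.           *)
Definition pi_partial_char (gT : finGroupType) (pi : nat_pred)
    (G : {group gT}) (phi : 'CF(G)) : Prop :=
  exists chi : 'CF(G), [/\ chi \is a character, chi != 0 & phi = cf_pi pi chi].

(* The set I_pi(G). *)
Definition pi_irr (gT : finGroupType) (pi : nat_pred) (G : {group gT})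
    (phi : 'CF(G)) : Prop :=
  pi_partial_char pi phi /\
  ~ (exists phi1 phi2 : 'CF(G),
       [/\ pi_partial_char pi phi1, pi_partial_char pi phi2
         & phi = phi1 + phi2]).

Definition pi_linear (gT : finGroupType) (pi : nat_pred) (G : {group gT})
    (phi : 'CF(G)) : Prop :=
  pi_partial_char pi phi /\ phi 1%g = 1.

Definition monomial (gT : finGroupType) (G : {group gT})
    (chi : 'CF(G)) : Prop :=
  exists H : {group gT}, H \subset G /\
  exists lambda : 'CF(H),
    lambda \is a linear_char /\ chi = 'Ind[G] lambda.

(* As partial characters are extended by zero outside pi-elements, and         *)
(* conjugation preserves these, the induction of partial characters is the     *)
(* ordinary induction of class functions; see [cfInd_pi_on] and [cfInd_conjE]. *)
Definition pi_monomial (gT : finGroupType) (pi : nat_pred) (G : {group gT})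
    (phi : 'CF(G)) : Prop :=
  exists H : {group gT}, H \subset G /\
  exists nu : 'CF(H), pi_linear pi nu /\ phi = 'Ind[G] nu.

Lemma cfInd_conjE (gT : finGroupType) (G H : {group gT}) (nu : 'CF(H)) g :
  H \subset G ->
  'Ind[G] nu g =
    #|H|%:R^-1 *
    \sum_(x in G | (x * g * x^-1)%g \in H) nu (x * g * x^-1)%g.
Proof.
move=> sHG; rewrite cfIndE //; congr (_ * _).
rewrite (reindex_inj invg_inj) big_mkcondr /=; apply: eq_big => x.
  by rewrite groupV.
move=> _; rewrite conjgE invgK mulgA; case: ifPn => // notHx.
by rewrite cfun0.
Qed.

Lemma cfInd_pi_on (gT : finGroupType) (pi : nat_pred) (G H : {group gT})
    (nu : 'CF(H)) :
    H \subset G -> nu \in 'CF(H, pi_elements pi H) ->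
  'Ind[G] nu \in 'CF(G, pi_elements pi G).
Proof.
move=> sHG /cfun_onP nu0; apply/cfun_onP=> g; rewrite inE negb_and.
case/orP=> [notGg | pi'g]; first exact: cfun0.
rewrite cfIndE // big1 ?mulr0 // => x _.
by apply: nu0; rewrite inE p_eltJ (negPf pi'g) andbF.
Qed.

(* Main.v *)
Require Import Defs.
From HB Require Import structures.
From mathcomp Require Import all_boot all_order all_fingroup all_algebra.
From mathcomp Require Import all_solvable all_field all_character.
Set Implicit Arguments.
Unset Strict Implicit.
Unset Printing Implicit Defensive.
Import GroupScope GRing.Theory.
Local Open Scope ring_scope.

(** Whether an element is a [pi]-element depends only on its order, hence is
    invariant under conjugation.  The induction formula at [g] only involves
    values at conjugates of [g], so restricting to [pi]-elements commutes with
    induction ([cf_pi_Ind]).  If [chi] is induced from a linear character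
    [lambda] of [H], then [phi], the restriction of [chi], is therefore induced
    from the restriction of [lambda], which is a linear partial character of
    the same [H] because the identity is a [pi]-element
    ([cf_pi_linear]). *)

Lemma cf_pi_Ind (gT : finGroupType) (pi : nat_pred) (G H : {group gT})
    (nu : 'CF(H)) :
  H \subset G -> cf_pi pi ('Ind[G] nu) = 'Ind[G] (cf_pi pi nu).
Proof.
move=> sHG; apply/cfun_inP=> g Gg.
rewrite cf_piE !inE Gg /= !cfIndE //; case: ifPn => pi_g.
  congr (_ * _); apply: eq_bigr => x _; rewrite cf_piE inE p_eltJ pi_g andbT.
  by case: ifPn => // /cfun0.
by rewrite big1 ?mulr0 // => x _; rewrite cf_piE inE p_eltJ (negPf pi_g) andbF.
Qed.

Lemma cf_pi_linear (gT : finGroupType) (pi : nat_pred) (H : {group gT})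
    (lambda : 'CF(H)) :
  lambda \is a linear_char -> pi_linear pi (cf_pi pi lambda).
Proof.
move=> lin_lambda; split.
  exists lambda; split=> //; first exact: lin_charW.
  apply: contraTneq lin_lambda => ->.
  by rewrite qualifE /= cfunE eq_sym oner_eq0 andbF.
by rewrite cf_piE inE group1 p_elt1 lin_char1.
Qed.

Theorem lemma3p5 (gT : finGroupType) (pi : nat_pred) (G : {group gT})
    (chi phi : 'CF(G)) :
  pi_separable pi G ->
  chi \in irr G ->
  cf_pi pi chi = phi ->
  pi_irr pi phi ->
  monomial chi ->
  pi_monomial pi phi.
Proof.
move=> _ _ <- _ [H [sHG [lambda [lin_lambda ->]]]].
exists H; split=> //; exists (cf_pi pi lambda); split.
  exact: cf_pi_linear.
exact: cf_pi_Ind.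
Qed.
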